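(* Let $\overline{\,\cdot\,}$ be a continuous antilinear involution on $V$. Then the induced $^*$-involution on $\mathcal{T}^\bullet(V)$ is also continuous.
   Context: $V$ is a complex Hausdorff locally convex space whose topology is given by its continuous Hilbert seminorms: let $\mathcal{I}_V$ be the set of continuous positive Hermitian forms $\langle\cdot\,|\,\cdot\rangle_\alpha$ on $V$ (sesquilinear, antilinear in the first argument, Hermitian, positive semi-definite), put $\|v\|_\alpha:=\sqrt{\langle v|v\rangle_\alpha}$, and let $\mathcal{P}_V$ be the set of all these seminorms; it is assumed that $\mathcal{P}_V$ is cofinal in the set of all continuous seminorms on $V$. Let $\mathcal{T}^k_{\mathrm{alg}}(V)$ be the algebraic $k$-th tensor power ($\mathcal{T}^0_{\mathrm{alg}}(V)=\mathbb{C}$), $\mathcal{T}^\bullet_{\mathrm{alg}}(V)=\bigoplus_{k\ge 0}\mathcal{T}^k_{\mathrm{alg}}(V)$, and $\langle X\rangle_k$ the degree-$k$ component of $X$. Each $\langle\cdot|\cdot\rangle_\alpha\in\mathcal{I}_V$ is extended to a positive Hermitian form $\langle X|Y\rangle_\alpha^\bullet:=\sum_{k}\langle\langle X\rangle_k|\langle Y\rangle_k\rangle_\alpha^\bullet$ on $\mathcal{T}^\bullet_{\mathrm{alg}}(V)$, where $\langle x_1\otimes\cdots\otimes x_k|y_1\otimes\cdots\otimes y_k\rangle_\alpha^\bullet:=k!\prod_{m=1}^k\langle x_m|y_m\rangle_\alpha$; set $\|X\|_\alpha^\bullet:=\sqrt{\langle X|X\rangle_\alpha^\bullet}$. $\mathcal{T}^\bullet(V)$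 is $\mathcal{T}^\bullet_{\mathrm{alg}}(V)$ with the locally convex topology defined by all seminorms $\|\cdot\|_\alpha^\bullet$, $\|\cdot\|_\alpha\in\mathcal{P}_V$. Given an antilinear involution $\overline{\,\cdot\,}$ on $V$, the induced $^*$-involution on $\mathcal{T}^\bullet(V)$ is the antilinear map with $(x_1\otimes\cdots\otimes x_k)^*:=\overline{x_k}\otimes\cdots\otimes\overline{x_1}$ for $k\ge1$, $x_i\in V$, and complex conjugation on $\mathcal{T}^0=\mathbb{C}$. *)

(* Defs.v *)
From HB Require Import structures.
From mathcomp Require Import all_boot all_order all_algebra.
From mathcomp Require Import boolp classical_sets functions cardinality fsbigop.
From mathcomp Require Import reals topology normedtype.
From mathcomp Require Import complex freeg.

Set Implicit Arguments.
Unset Strict Implicit.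
Unset Printing Implicit Defensive.

Import Order.TTheory GRing.Theory Num.Theory.
Import numFieldNormedType.Exports.

Local Open Scope classical_set_scope.
Local Open Scope quotient_scope.
Local Open Scope ring_scope.

Section Forms.
Context (C : numClosedFieldType) (V : lmodType C).

(* Linearity in the second argument and Hermitian symmetry give antilinearity
   in the first argument. *)
Definition pos_herm_form (a : V -> V -> C) : Prop :=
  [/\ forall x c y z, a x (c *: y + z) = c * a x y + a x z,
      forall x y, a x y = (a y x)^*
    & forall x, 0 <= a x x].

(* As for the norms of normed modules over C, seminorms take their values in
   the nonnegative (hence real) elements of C. *)
Definition herm_norm (a : V -> V -> C) (x : V) : C := sqrtC (a x x).

Definition is_seminorm (p : V -> C) : Prop :=
  [/\ forall x, 0 <= p x,
      forall x y, p (x + y) <= p x + p y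
    & forall c x, p (c *: x) = `|c| * p x].

Definition antilinear (f : V -> V) : Prop :=
  forall c x y, f (c *: x + y) = c^* *: f x + f y.

Definition antilinear_involution (f : V -> V) : Prop :=
  antilinear f /\ involutive f.

End Forms.

Section FreeModule.
Context (C : nzRingType) (K : choiceType).
Implicit Types D E : {freeg K / C}.

Section Semilinear.
Context (M : lmodType C) (F : K -> C -> M) (s : C -> C).
Hypothesis F_semilin : forall x c a b, F x (c * a + b) = s c *: F x a + F x b.
Hypothesis F0 : forall x, F x 0 = 0.

Lemma dom_sum_widen D (r : seq K) : uniq r -> {subset dom D <= r} ->
  \sum_(x <- dom D) F x (coeff x D) = \sum_(x <- r) F x (coeff x D).
Proof.
move=> ur Dr; rewrite [RHS](bigID (mem (dom D))) /= [X in _ = _ + X]big1.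
  rewrite addr0 -[RHS]big_filter; apply: perm_big; apply: uniq_perm.
  - exact: uniq_dom.
  - exact: filter_uniq.
  by move=> x; rewrite mem_filter /=; case: (boolP (x \in dom D)) => //= /Dr ->.
by move=> x xD; rewrite coeff_outdom.
Qed.

Lemma dom_sum_semilin c D E :
  \sum_(x <- dom (c *: D + E)) F x (coeff x (c *: D + E)) =
  s c *: (\sum_(x <- dom D) F x (coeff x D)) + \sum_(x <- dom E) F x (coeff x E).
Proof.
pose r := undup (dom (c *: D + E) ++ dom D ++ dom E).
rewrite !(@dom_sum_widen _ r) ?undup_uniq //; try by
  move=> x xD; rewrite mem_undup !mem_cat xD ?orbT.
rewrite scaler_sumr -big_split /=; apply: eq_bigr => x _.
by rewrite coeffD coeffZ F_semilin.
Qed.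

Lemma dom_sumU a x :
  \sum_(y <- dom << a *g x >>) F y (coeff y << a *g x >>) = F x a.
Proof.
have [->|a0] := eqVneq a 0; first by rewrite freegU0 dom0 big_nil F0.
by rewrite domU // big_seq1 coeffU eqxx mulr1.
Qed.

End Semilinear.
End FreeModule.

Section TensorPower.
Context (C : numClosedFieldType) (V : lmodType C) (k : nat).

Notation word := {ffun 'I_k -> V}.
Notation free := {freeg word / C}.
Implicit Types (x y : word) (D E : free).

Definition upd x (i : 'I_k) (v : V) : word :=
  [ffun j => if j == i then v else x j].

(* The submodule of the free module on V^k generated by the multilinearity
   relations. *)
Inductive multilinear_rel : free -> Prop :=
| mrel_gen x (i : 'I_k) (c : C) (u v : V) :
    multilinear_rel (<< upd x i (c *: u + v) >>
                     - (c *: << upd x i u >> + << upd x i v >>))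
| mrel_zero : multilinear_rel 0
| mrel_lin (c : C) D E :
    multilinear_rel D -> multilinear_rel E -> multilinear_rel (c *: D + E).

Definition mrel : pred free := fun D => `[< multilinear_rel D >].

Lemma mrel_zmod_closed : zmod_closed mrel.
Proof.
split=> [|D E]; first by apply/asboolP; exact: mrel_zero.
move=> /asboolP rD /asboolP rE; apply/asboolP.
by rewrite addrC -scaleN1r; exact: mrel_lin.
Qed.
HB.instance Definition _ := GRing.isZmodClosed.Build free mrel mrel_zmod_closed.

Definition mrel_submod : zmodClosed free := GRing.ZmodClosed.clone free mrel _.

Definition tpow : Type := Quotient.quot mrel_submod.
HB.instance Definition _ :=
  GRing.Zmodule.copy tpow (Quotient.quot mrel_submod).

Definition tpi : free -> tpow := \pi_(Quotient.quot mrel_submod).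
Definition trepr : tpow -> free := @repr _ (Quotient.quot mrel_submod).

Lemma treprK : cancel trepr tpi.
Proof. exact: reprK. Qed.

Lemma tpi_eqP D E : tpi D = tpi E <-> multilinear_rel (D - E).
Proof.
split=> [/eqP|DE]; last apply/eqP.
  by rewrite /tpi -Quotient.idealrBE => /asboolP.
by rewrite /tpi -Quotient.idealrBE; apply/asboolP.
Qed.

Lemma tpiD : {morph tpi : D E / D + E}.
Proof. exact: (raddfD (\pi_(Quotient.quot mrel_submod))). Qed.

Lemma trepr_tpi D : multilinear_rel (trepr (tpi D) - D).
Proof. by apply/tpi_eqP; rewrite treprK. Qed.

Definition tscale (c : C) (X : tpow) : tpow := tpi (c *: trepr X).

Lemma tscale_tpi c D : tscale c (tpi D) = tpi (c *: D).
Proof.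
apply/tpi_eqP; rewrite -scalerBr -[_ *: _]addr0; apply: mrel_lin.
  exact: trepr_tpi.
exact: mrel_zero.
Qed.

Lemma tscaleA c d X : tscale c (tscale d X) = tscale (c * d) X.
Proof. by rewrite -(treprK X) !tscale_tpi scalerA. Qed.

Lemma tscale1 : left_id 1 tscale.
Proof. by move=> X; rewrite -(treprK X) tscale_tpi scale1r. Qed.

Lemma tscaleDr : right_distributive tscale +%R.
Proof.
by move=> c X Y; rewrite -(treprK X) -(treprK Y) -tpiD !tscale_tpi scalerDr tpiD.
Qed.

Lemma tscaleDl X : {morph tscale^~ X : c d / c + d}.
Proof. by move=> c d; rewrite -(treprK X) !tscale_tpi scalerDl tpiD. Qed.

HB.instance Definition _ := GRing.Zmodule_isLmodule.Build C tpow
  tscaleA tscale1 tscaleDr tscaleDl.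

Lemma tpi_lin c D E : tpi (c *: D + E) = c *: tpi D + tpi E.
Proof. by rewrite tpiD -tscale_tpi. Qed.

Definition ptens x : tpow := tpi << x >>.

Lemma ptens_multilinear x i c u v :
  ptens (upd x i (c *: u + v)) =
  c *: ptens (upd x i u) + ptens (upd x i v).
Proof. by rewrite -tpi_lin; apply/tpi_eqP; exact: mrel_gen. Qed.

Definition word_form (a : V -> V -> C) x y : C :=
  k`!%:R * \prod_(m < k) a (x m) (y m).

Definition free_form (a : V -> V -> C) D E : C :=
  \sum_(x <- dom D) \sum_(y <- dom E)
    (coeff x D)^* * coeff y E * word_form a x y.

(* Independent of the representatives as soon as [a] is a positive Hermitian
   form: see [tpow_form_tpi] below. *)
Definition tpow_form (a : V -> V -> C) (X Y : tpow) : C :=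
  free_form a (trepr X) (trepr Y).

Section FormTheory.
Variable a : V -> V -> C.
Hypothesis ha : pos_herm_form a.

Lemma word_formC x y : word_form a x y = (word_form a y x)^*.
Proof.
case: ha => _ aC _; rewrite /word_form rmorphM /= conjC_nat rmorph_prod /=.
by congr (_ * _); apply: eq_bigr => m _; exact: aC.
Qed.

Lemma word_form_upd x y i c u v :
  word_form a x (upd y i (c *: u + v)) =
  c * word_form a x (upd y i u) + word_form a x (upd y i v).
Proof.
have E w : word_form a x (upd y i w) =
    k`!%:R * \prod_(m < k | m != i) a (x m) (y m) * a (x i) w.
  rewrite /word_form (bigD1 i) //= ffunE eqxx -mulrA; congr (_ * _).
  rewrite mulrC; congr (_ * _); apply: eq_bigr => m mi.
  by rewrite ffunE (negbTE mi).
by case: ha => al _ _; rewrite !E al mulrDr mulrCA.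
Qed.

Lemma free_formC D E : free_form a D E = (free_form a E D)^*.
Proof.
rewrite /free_form rmorph_sum exchange_big /=; apply: eq_bigr => y _.
rewrite rmorph_sum; apply: eq_bigr => x _.
by rewrite word_formC 2!rmorphM /= conjCK; congr (_ * _); exact: mulrC.
Qed.

Lemma free_formE D E : free_form a D E =
  \sum_(y <- dom E)
    (coeff y E * \sum_(x <- dom D) (coeff x D)^* * word_form a x y : C^o).
Proof.
rewrite /free_form exchange_big /=; apply: eq_bigr => y _.
by rewrite mulr_sumr; apply: eq_bigr => x _; rewrite [RHS]mulrA; congr (_ * _); rewrite mulrC.
Qed.

Lemma free_form_lin D c E1 E2 :
  free_form a D (c *: E1 + E2) = c * free_form a D E1 + free_form a D E2.
Proof.
pose F y b : C^o := b * \sum_(x <- dom D) (coeff x D)^* * word_form a x y.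
have := @dom_sum_semilin C _ _ F id _ _ c E1 E2; rewrite !free_formE => -> //.
- by move=> y d b1 b2; rewrite /F mulrDl -mulrA.
- by move=> y; rewrite /F mul0r.
Qed.

Lemma free_form_gen D y : free_form a D << y >> =
  \sum_(x <- dom D) (coeff x D)^* * word_form a x y.
Proof.
pose F y b : C^o := b * \sum_(x <- dom D) (coeff x D)^* * word_form a x y.
have := @dom_sumU C _ _ F _ 1 y; rewrite free_formE => ->; rewrite /F ?mul1r //.
by move=> z; rewrite mul0r.
Qed.

Lemma free_form_rel D E : multilinear_rel E -> free_form a D E = 0.
Proof.
have fD0 : free_form a D 0 = 0.
  by rewrite free_formE dom0 big_nil.
elim=> [y i c u v| |c E1 E2 _ h1 _ h2] //; last first.
  by rewrite free_form_lin h1 h2 mulr0 addr0.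
rewrite addrC -scaleN1r free_form_lin free_form_lin !free_form_gen.
rewrite mulN1r mulr_sumr -big_split /= addrC -sumrB big1 // => x _.
by rewrite word_form_upd mulrDr mulrCA subrr.
Qed.

Lemma tpow_form_tpi D E : tpow_form a (tpi D) (tpi E) = free_form a D E.
Proof.
have rel_r D1 E1 E2 : multilinear_rel (E1 - E2) ->
    free_form a D1 E1 = free_form a D1 E2.
  move=> r; rewrite -[E1](subrK E2) -[E1 - E2]scale1r free_form_lin.
  by rewrite free_form_rel // mulr0 add0r.
rewrite /tpow_form (rel_r _ _ _ (trepr_tpi E)) free_formC.
by rewrite (rel_r _ _ _ (trepr_tpi D)) -free_formC.
Qed.

Lemma tpow_formC X Y : tpow_form a X Y = (tpow_form a Y X)^*.
Proof. exact: free_formC. Qed.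

Lemma tpow_form_lin X c Y Z :
  tpow_form a X (c *: Y + Z) = c * tpow_form a X Y + tpow_form a X Z.
Proof.
rewrite -(treprK X) -(treprK Y) -(treprK Z) -tpi_lin !tpow_form_tpi.
exact: free_form_lin.
Qed.

Lemma tpow_form_ptens x y :
  tpow_form a (ptens x) (ptens y) = k`!%:R * \prod_(m < k) a (x m) (y m).
Proof.
rewrite tpow_form_tpi free_form_gen domU1 big_seq1 coeffU eqxx mulr1.
by rewrite conjC1 mul1r.
Qed.

End FormTheory.

Definition word_star (f : V -> V) x : word := [ffun m => f (x (rev_ord m))].

Definition free_star (f : V -> V) D : free :=
  \sum_(x <- dom D) << (coeff x D)^* *g word_star f x >>.

(* Independent of the representative as soon as [f] is antilinear: see
   [tpow_star_tpi] below. *)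
Definition tpow_star (f : V -> V) (X : tpow) : tpow :=
  tpi (free_star f (trepr X)).

Section StarTheory.
Variable f : V -> V.
Hypothesis hf : antilinear f.

Let star_term x (b : C) : free := << b^* *g word_star f x >>.

Let star_term_semilin x c b1 b2 :
  star_term x (c * b1 + b2) = c^* *: star_term x b1 + star_term x b2.
Proof.
apply/eqP/freeg_eqP => y; rewrite coeffD coeffZ !coeffU.
by rewrite rmorphD rmorphM mulrDl mulrA.
Qed.

Let star_term0 x : star_term x 0 = 0.
Proof. by rewrite /star_term conjC0 freegU0. Qed.

Lemma free_star_antilin c D E :
  free_star f (c *: D + E) = c^* *: free_star f D + free_star f E.
Proof. exact: (dom_sum_semilin star_term_semilin star_term0). Qed.

Lemma free_star_gen x : free_star f << x >> = << word_star f x >>.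
Proof.
by rewrite [LHS](dom_sumU star_term0) /star_term conjC1.
Qed.

Lemma free_star0 : free_star f 0 = 0.
Proof. by rewrite /free_star dom0 big_nil. Qed.

Lemma word_star_upd x i v :
  word_star f (upd x i v) = upd (word_star f x) (rev_ord i) (f v).
Proof.
apply/ffunP => m; rewrite !ffunE.
by rewrite -[m == _](inj_eq rev_ord_inj) rev_ordK; case: ifP.
Qed.

Lemma free_star_rel D : multilinear_rel D -> multilinear_rel (free_star f D).
Proof.
elim=> [x i c u v| |c D1 D2 _ h1 _ h2].
- rewrite addrC -scaleN1r free_star_antilin free_star_antilin !free_star_gen.
  rewrite conjCN1 scaleN1r addrC !word_star_upd hf; exact: mrel_gen.
- by rewrite free_star0; exact: mrel_zero.
- by rewrite free_star_antilin; exact: mrel_lin.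
Qed.

Lemma tpow_star_tpi D : tpow_star f (tpi D) = tpi (free_star f D).
Proof.
apply/tpi_eqP; have := free_star_rel (trepr_tpi D).
by rewrite addrC -scaleN1r free_star_antilin conjCN1 scaleN1r addrC.
Qed.

Lemma tpow_star_antilin c X Y :
  tpow_star f (c *: X + Y) = c^* *: tpow_star f X + tpow_star f Y.
Proof.
rewrite -(treprK X) -(treprK Y) -tpi_lin !tpow_star_tpi free_star_antilin.
exact: tpi_lin.
Qed.

Lemma tpow_star_ptens x :
  tpow_star f (ptens x) = ptens [ffun m => f (x (rev_ord m))].
Proof. by rewrite tpow_star_tpi free_star_gen. Qed.

Lemma tpow_star0 : tpow_star f 0 = 0.
Proof.
have := tpow_star_antilin 1 0 0; rewrite scaler0 addr0 conjC1 scale1r.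
by move=> h; apply: (addrI (tpow_star f 0)); rewrite addr0 -h.
Qed.

End StarTheory.
End TensorPower.

Arguments multilinear_rel {C V k}.
Arguments tpi {C V k}.
Arguments trepr {C V k}.

Section TensorAlgebra.
Context (C : numClosedFieldType) (V : lmodType C).

Record tensalg := TensAlg {
  comp :> forall k, tpow V k;
  comp_fin : exists n, forall k, (n <= k)%N -> comp k = 0 }.

HB.instance Definition _ := gen_eqMixin tensalg.
HB.instance Definition _ := gen_choiceMixin tensalg.

Lemma tensalgP (X Y : tensalg) : (forall k, X k = Y k) -> X = Y.
Proof.
case: X Y => [X hX] [Y hY] /= XY; have {}XY : X = Y.
  exact: functional_extensionality_dep.
by subst Y; congr TensAlg; exact: Prop_irrelevance.
Qed.

Lemma tzero_fin : exists n, forall k, (n <= k)%N -> (0 : tpow V k) = 0.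
Proof. by exists 0%N. Qed.

Lemma topp_fin (X : tensalg) :
  exists n, forall k, (n <= k)%N -> - X k = 0.
Proof. by case: (comp_fin X) => n h; exists n => k /h ->; rewrite oppr0. Qed.

Lemma tadd_fin (X Y : tensalg) :
  exists n, forall k, (n <= k)%N -> X k + Y k = 0.
Proof.
case: (comp_fin X) (comp_fin Y) => n hn [m hm]; exists (maxn n m) => k.
by rewrite geq_max => /andP[/hn -> /hm ->]; rewrite addr0.
Qed.

Lemma tscal_fin c (X : tensalg) :
  exists n, forall k, (n <= k)%N -> c *: X k = 0.
Proof. by case: (comp_fin X) => n h; exists n => k /h ->; rewrite scaler0. Qed.

Definition tzero := TensAlg tzero_fin.
Definition topp X := TensAlg (topp_fin X).
Definition tadd X Y := TensAlg (tadd_fin X Y).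
Definition tscal c X := TensAlg (tscal_fin c X).

Lemma taddA : associative tadd.
Proof. by move=> X Y Z; apply: tensalgP => k; exact: addrA. Qed.

Lemma taddC : commutative tadd.
Proof. by move=> X Y; apply: tensalgP => k; exact: addrC. Qed.

Lemma tadd0 : left_id tzero tadd.
Proof. by move=> X; apply: tensalgP => k; exact: add0r. Qed.

Lemma taddN : left_inverse tzero topp tadd.
Proof. by move=> X; apply: tensalgP => k; exact: addNr. Qed.

HB.instance Definition _ :=
  GRing.isZmodule.Build tensalg taddA taddC tadd0 taddN.

Lemma tscalA c d X : tscal c (tscal d X) = tscal (c * d) X.
Proof. by apply: tensalgP => k; exact: scalerA. Qed.

Lemma tscal1 : left_id 1 tscal.
Proof. by move=> X; apply: tensalgP => k; exact: scale1r. Qed.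

Lemma tscalDr : right_distributive tscal +%R.
Proof. by move=> c X Y; apply: tensalgP => k; exact: scalerDr. Qed.

Lemma tscalDl X : {morph tscal^~ X : c d / c + d}.
Proof. by move=> c d; apply: tensalgP => k; exact: scalerDl. Qed.

HB.instance Definition _ := GRing.Zmodule_isLmodule.Build C tensalg
  tscalA tscal1 tscalDr tscalDl.

(* The summation over all degrees has finite support, since X and Y do. *)
Definition tform (a : V -> V -> C) (X Y : tensalg) : C :=
  \sum_(k \in [set: nat]) tpow_form a (X k) (Y k).

Definition tnorm (a : V -> V -> C) (X : tensalg) : C := sqrtC (tform a X X).

Lemma tstar_fin (f : V -> V) : antilinear f -> forall X : tensalg,
  exists n, forall k, (n <= k)%N -> tpow_star f (X k) = 0.
Proof.
move=> hf X; case: (comp_fin X) => n h; exists n => k /h ->.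
exact: tpow_star0.
Qed.

Definition tstar (f : V -> V) (hf : antilinear_involution f) (X : tensalg) :
  tensalg := TensAlg (tstar_fin hf.1 X).

End TensorAlgebra.

Section Topology.
Context (R : realType) (V : tvsType R[i]).

(* [R[i]^o] carries the usual topology of the complex numbers. *)
Definition cont_herm_form : set (V -> V -> R[i]) :=
  [set a | pos_herm_form a /\ continuous (fun xy : V * V => a xy.1 xy.2 : R[i]^o)].

Definition hilbert_seminorms_cofinal : Prop :=
  forall p : V -> R[i], is_seminorm p -> continuous (p : V -> R[i]^o) ->
  exists2 a, cont_herm_form a & forall x, p x <= herm_norm a x.

Definition tens_top : Type := tensalg V.
HB.instance Definition _ := GRing.Lmodule.copy tens_top (tensalg V).

Definition tball (a : V -> V -> R[i]) (X : tens_top) (e : R[i]) :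
  set tens_top := [set Y | tnorm a (Y - X) < e].

(* The locally convex topology defined by the seminorms [tnorm a]: the open
   balls of these seminorms form a subbase. *)
Definition seminorm_balls : set (set tens_top) :=
  [set B | exists a X e, [/\ cont_herm_form a, 0 < e & B = tball a X e]].

HB.instance Definition _ :=
  isSubBaseTopological.Build tens_top seminorm_balls id.

End Topology.

(* Main.v *)
Require Import Defs.
From HB Require Import structures.
From mathcomp Require Import all_boot all_order all_algebra.
From mathcomp Require Import boolp classical_sets functions cardinality fsbigop.
From mathcomp Require Import reals topology normedtype.
From mathcomp Require Import complex freeg.
Import Order.TTheory GRing.Theory Num.Theory.
Import numFieldNormedType.Exports.

(** The involution turns each defining seminorm of the tensor algebra into
another defining seminorm, without any loss, so that it permutes the open balls
which generate the topology.

Given a continuous positive Hermitian form [a] and a continuous antilinear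
involution [f] of V, the form [b x y := a (f y) (f x)], which is the complex
conjugate of [a (f x) (f y)], is again Hermitian, positive and continuous.  For
elementary tensors X and Y of degree k with factors x_m and y_m, both
[<star X | star Y>_a] and [<Y | X>_b] are k! times the product of the numbers
[a (f x_m) (f y_m)]: reversing the two words only permutes the factors, and k! depends on the degree alone.  Both sides are linear
in X and antilinear in Y, so they agree everywhere ([tpow_form_star]); summing
over the degrees gives that the a-norm of [star X] is the b-norm of X
([tnorm_star]).

As the star is an additive involution, [star Y - X = star (Y - star X)]; hence the
preimage of the a-ball around X is exactly the b-ball of the same radius around
[star X] ([preimage_tstar_tball]).  A map into a space generated by a subbase is
continuous as soon as the preimages of the members of the subbase are open
([continuous_tballP]). *)

Set Implicit Arguments.
Unset Strict Implicit.
Unset Printing Implicit Defensive.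

Local Open Scope classical_set_scope.
Local Open Scope ring_scope.

Section TensorPower.
Context (C : numClosedFieldType) (V : lmodType C) (k : nat).

(** Elementary tensors span, so identities between (anti)linear maps reduce to
them.  Absorbing the scalar into the step keeps every appeal to (anti)linearity
in the form [c *: x + y]. *)
Lemma tpow_ind (P : tpow V k -> Prop) :
  P 0 -> (forall c x X, P X -> P (c *: ptens x + X)) -> forall X, P X.
Proof.
move=> P0 PD X; rewrite -[X]treprK; elim/freeg_ind_dom0: (trepr X) => [|c x D _ _].
  by rewrite -[tpi 0](addrK (tpi 0)) -tpiD addr0 subrr.
move=> PX; suff -> : << c *g x >> = c *: << x >> :> {freeg {ffun 'I_k -> V} / C}.
  by rewrite tpi_lin; exact: PD.
by apply/eqP/freeg_eqP => y; rewrite coeffZ !coeffU mul1r.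
Qed.

Lemma tpow_star_involutive (f : V -> V) :
  antilinear_involution f -> involutive (@tpow_star C V k f).
Proof.
case=> hf fK X; elim/tpow_ind: X => [|c x X IH]; first by rewrite !tpow_star0.
rewrite !tpow_star_antilin // conjCK IH !tpow_star_ptens //.
by congr (_ *: ptens _ + _); apply/ffunP => m; rewrite !ffunE rev_ordK fK.
Qed.

Lemma tpow_form0 (a : V -> V -> C) (X : tpow V k) :
  pos_herm_form a -> tpow_form a X 0 = 0.
Proof.
move=> ha; have := tpow_form_lin ha X 1 0 0; rewrite scaler0 addr0 mul1r => h.
by apply: (addrI (tpow_form a X 0)); rewrite addr0 -h.
Qed.

End TensorPower.

(** The arguments are exchanged because [f] is antilinear: [a (f x) (f y)] would
be linear in the wrong argument. *)
Definition twisted_form (C : numClosedFieldType) (V : lmodType C) (f : V -> V)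
  (a : V -> V -> C) (x y : V) : C := a (f y) (f x).

Lemma pos_herm_twisted_form (C : numClosedFieldType) (V : lmodType C) (f : V -> V)
    (a : V -> V -> C) :
  antilinear f -> pos_herm_form a -> pos_herm_form (twisted_form f a).
Proof.
move=> hf [al aC a0]; split=> [x c y z|x y|x].
- rewrite /twisted_form hf aC al rmorphD rmorphM /= conjCK.
  by rewrite -[(a (f x) (f y))^*]aC -[(a (f x) (f z))^*]aC.
- exact: aC.
- exact: a0.
Qed.

(** By induction on Y and then on X, only elementary tensors remain; there the
order reversal of the star is undone by reindexing the product. *)
Lemma tpow_form_star (C : numClosedFieldType) (V : lmodType C) (k : nat)
    (f : V -> V) (a : V -> V -> C) (X Y : tpow V k) :
  antilinear f -> pos_herm_form a ->
  tpow_form a (tpow_star f X) (tpow_star f Y) = tpow_form (twisted_form f a) Y X.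
Proof.
move=> hf ha; have hb := pos_herm_twisted_form hf ha.
elim/tpow_ind: Y => [|d y Y IHY].
  by rewrite tpow_star0 // tpow_form0 // tpow_formC // tpow_form0 // conjC0.
rewrite tpow_star_antilin // tpow_form_lin // IHY.
rewrite [RHS]tpow_formC // tpow_form_lin // rmorphD rmorphM /= -!tpow_formC //.
congr (_ * _ + _); elim/tpow_ind: X {IHY Y} => [|c x X IHX].
  by rewrite tpow_star0 // tpow_formC // !tpow_form0 // conjC0.
rewrite tpow_star_antilin // [LHS]tpow_formC // [in LHS]tpow_form_lin //.
rewrite rmorphD rmorphM /= conjCK -!tpow_formC // IHX tpow_form_lin //.
congr (_ * _ + _); rewrite !tpow_star_ptens // !tpow_form_ptens //; congr (_ * _).
rewrite (reindex_inj rev_ord_inj) /=; apply: eq_bigr => m _.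
by rewrite !ffunE rev_ordK.
Qed.

(** The equality is exact, so no constant comparing the two norms appears and the
radii of balls are preserved. *)
Lemma tnorm_star (C : numClosedFieldType) (V : lmodType C) (f : V -> V)
    (hf : antilinear_involution f) (a : V -> V -> C) (X : tensalg V) :
  pos_herm_form a -> tnorm a (tstar hf X) = tnorm (twisted_form f a) X.
Proof.
move=> ha; congr sqrtC; apply: eq_fsbigr => k _.
by apply: tpow_form_star => //; exact: hf.1.
Qed.

(** This moves the centre of a ball across the star. *)
Lemma tstar_sub_shift (C : numClosedFieldType) (V : lmodType C) (f : V -> V)
    (hf : antilinear_involution f) (X Y : tensalg V) :
  tstar hf X - Y = tstar hf (X - tstar hf Y).
Proof.
apply: tensalgP => k; rewrite /= [in RHS]addrC -[in RHS]scaleN1r.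
rewrite tpow_star_antilin; last exact: hf.1.
by rewrite tpow_star_involutive // conjCN1 scaleN1r addrC.
Qed.

Section Topology.
Context (R : realType) (V : tvsType R[i]).

Lemma open_tball (a : V -> V -> R[i]) (X : tens_top V) (e : R[i]) :
  cont_herm_form a -> 0 < e -> open (tball a X e).
Proof.
move=> ha e0; exists [set tball a X e]; last by rewrite bigcup_set1.
move=> _ ->; apply: (@finI_from1 _ _ _ id).
by exists a, X, e.
Qed.

(** Finite intersections and arbitrary unions commute with preimages. *)
Lemma continuous_tballP (S : topologicalType) (g : S -> tens_top V) :
  (forall a X e, cont_herm_form a -> 0 < e -> open (g @^-1` tball a X e)) ->
  continuous g.
Proof.
move=> gb; apply/continuousP => _ [D sD <-].
rewrite preimage_bigcup; apply: bigcup_open => _ /sD [B sB <-].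
rewrite preimage_bigcap openE => s sBs; apply: filter_bigI => U UB.
have [a [X [e [ha e0 UE]]]] : seminorm_balls U by have := sB U UB; rewrite inE.
apply: open_nbhs_nbhs; split; last exact: sBs.
by rewrite UE; exact: gb.
Qed.

Lemma preimage_tstar_tball (f : V -> V) (hf : antilinear_involution f)
    (a : V -> V -> R[i]) (X : tens_top V) (e : R[i]) : pos_herm_form a ->
  (tstar hf : tens_top V -> tens_top V) @^-1` tball a X e =
  tball (twisted_form f a) (tstar hf X) e.
Proof.
move=> ha; apply/seteqP.
by split=> Y; rewrite /tball /= -(tnorm_star hf _ ha) -tstar_sub_shift.
Qed.

Lemma cont_herm_twisted_form (f : V -> V) (a : V -> V -> R[i]) :
  antilinear f -> continuous f -> cont_herm_form a ->
  cont_herm_form (twisted_form f a).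
Proof.
move=> hf cf [ha ca]; split; first exact: pos_herm_twisted_form.
move=> [x y]; apply: (@continuous_comp _ _ _ (fun z : V * V => (f z.2, f z.1))
  (fun z => a z.1 z.2 : R[i]^o)); last exact: ca.
apply: cvg_pair; first exact: (cvg_comp snd f cvg_snd (cf y)).
exact: (cvg_comp fst f cvg_fst (cf x)).
Qed.

End Topology.

Theorem proposition3p1 (R : realType) (V : tvsType R[i])
    (V_hausdorff : hausdorff_space V)
    (V_hilbert : hilbert_seminorms_cofinal V)
    (bar : V -> V) (bar_invol : antilinear_involution bar)
    (bar_cont : continuous bar) :
  continuous (tstar bar_invol : tens_top V -> tens_top V).
Proof.
apply: continuous_tballP => a X e ha e0.
rewrite (preimage_tstar_tball bar_invol X e ha.1).
exact: open_tball (cont_herm_twisted_form bar_invol.1 bar_cont ha) e0.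
Qed.
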